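(* Let $G=(V,E)$ be any graph, and let $(V,w)$ be the energy game on $G$, i.e. $w(S)=\mathcal{E}(I(S))$ for every $S\subset V$. Then $(V,w)$ is superadditive: for all $S,T\subset V$ with $S\cap T=\emptyset$, $$w(S\cup T)\geq w(S)+w(T).$$
   Context: Graphs are finite, simple (no loops or multiple edges) and undirected. For $G=(V,E)$ with $V=\{v_1,\dots,v_n\}$, the adjacency matrix $A(G)$ is the $n\times n$ matrix with $A_{ij}=1$ if $v_i$ and $v_j$ are adjacent and $A_{ij}=0$ otherwise. The energy of $G$ is $\mathcal{E}(G)=\sum_{i=1}^n|\lambda_i|=\operatorname{Tr}(|A(G)|)$, where $\lambda_1,\dots,\lambda_n$ are the eigenvalues of $A(G)$ with multiplicity and $|M|=(MM^* )^{1/2}$; the empty graph has energy $0$. For $S\subset V$, $I(S)$ denotes the subgraph of $G$ induced by $S$ (vertex set $S$, and all edges of $G$ with both endpoints in $S$). *)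

(* Defs.v *)
From mathcomp Require Import all_boot all_order all_algebra.

Set Implicit Arguments.
Unset Strict Implicit.
Unset Printing Implicit Defensive.

Import Order.TTheory GRing.Theory Num.Theory.
Local Open Scope ring_scope.

Record graph := Graph {
  vertex :> finType;
  adj : rel vertex;
  adj_sym : symmetric adj;
  adj_irr : irreflexive adj
}.

Section Induced.
Variables (G : graph) (S : {set G}).

Definition induced_adj : rel {x : G | x \in S} :=
  fun x y => adj (val x) (val y).

Lemma induced_adj_sym : symmetric induced_adj.
Proof. by move=> x y; apply: adj_sym. Qed.

Lemma induced_adj_irr : irreflexive induced_adj.
Proof. by move=> x; apply: adj_irr. Qed.

Definition induced : graph := Graph induced_adj_sym induced_adj_irr.

End Induced.

(* [C] plays the role of the complex numbers: it may be [algC], or [R[i]] for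
   any real closed field [R].  For [x y : C], [x <= y] means that [y - x] is
   real and nonnegative. *)
Section Energy.
Variable C : numClosedFieldType.

(* The vertices are numbered by [enum_val : 'I_#|G| -> G]. *)
Definition adjacency (G : graph) : 'M[C]_#|G| :=
  \matrix_(i, j) (adj (enum_val i) (enum_val j))%:R.

(* Listed with algebraic multiplicity, see [char_poly_eigenvalues]. *)
Definition eigenvalues n (A : 'M[C]_n) : seq C :=
  sval (closed_field_poly_normal (char_poly A)).

Lemma char_poly_eigenvalues n (A : 'M[C]_n) :
  char_poly A = \prod_(z <- eigenvalues A) ('X - z%:P).
Proof.
rewrite /eigenvalues; case: closed_field_poly_normal => r /= {1}->.
by rewrite (monicP (char_poly_monic A)) scale1r.
Qed.

Definition energy (G : graph) : C :=
  \sum_(z <- eigenvalues (adjacency G)) `|z|.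

Lemma energy_ge0 G : 0 <= energy G.
Proof. by apply: sumr_ge0 => z _; apply: normr_ge0. Qed.

Definition energy_game (G : graph) (S : {set G}) : C := energy (induced S).

Lemma energy_game0 G : @energy_game G set0 = 0.
Proof.
rewrite /energy_game /energy; move: (adjacency _).
have -> : #|induced (set0 : {set G})| = 0%N.
  by apply: eq_card0 => -[x x0]; have := x0; rewrite in_set0.
move=> A; have := size_char_poly A.
rewrite char_poly_eigenvalues size_prod_XsubC => -[/size0nil->].
by rewrite big_nil.
Qed.

Definition superadditive (V : finType) (w : {set V} -> C) : Prop :=
  forall S T : {set V}, S :&: T = set0 -> w S + w T <= w (S :|: T).

End Energy.

(* Main.v *)
(** Let [M] be hermitian with eigenvalues [d_j], and let [V] be a matrix whose
    columns are unit vectors.  The diagonal entries of [V diag(d) V^*] are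
    [\sum_j d_j |V i j|^2], so the sum of their moduli is at most
    [\sum_j |d_j|].  If two principal blocks of [M] partition the indices,
    then diagonalizing each of them by a unitary matrix exhibits all of their
    eigenvalues together as such diagonal entries. *)

Require Import Defs.
From mathcomp Require Import all_boot all_order all_algebra.

Set Implicit Arguments.
Unset Strict Implicit.
Unset Printing Implicit Defensive.

Import Order.TTheory GRing.Theory Num.Theory.
Local Open Scope ring_scope.
Local Open Scope sesquilinear_scope.

Lemma char_poly_conj (R : comUnitRingType) n (P A : 'M[R]_n) :
  P \in unitmx -> char_poly (invmx P *m A *m P) = char_poly A.
Proof.
move=> Pu; rewrite /char_poly.
have -> : char_poly_mx (invmx P *m A *m P) =
    map_mx polyC (invmx P) *m char_poly_mx A *m map_mx polyC P.
  rewrite /char_poly_mx !map_mxM mulmxBr mulmxBl; congr (_ - _).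
  by rewrite scalar_mxC -mulmxA -map_mxM mulVmx // map_mx1 mulmx1.
by rewrite !det_mulmx mulrAC -det_mulmx -map_mxM mulVmx // map_mx1 det1 mul1r.
Qed.

Section TraceNorm.
Variable C : numClosedFieldType.

Lemma hermitian_normal n (A : 'M[C]_n) : A ^t* = A -> A \is normalmx.
Proof. by move=> hA; apply/normalmxP; rewrite hA. Qed.

Lemma spectral_eigenvalues n (A : 'M[C]_n) : A \is normalmx ->
  perm_eq (eigenvalues A) [seq spectral_diag A 0 j | j : 'I_n].
Proof.
move=> /orthomx_spectralP An; apply: prod_XsubC_eq.
rewrite -char_poly_eigenvalues {1}An char_poly_conj ?spectral_unit //.
rewrite char_poly_trig ?diag_mx_is_trig // big_image /=.
by apply: eq_bigr => j _; rewrite mxE eqxx mulr1n.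
Qed.

Lemma sum_norm_eigenvalues n (A : 'M[C]_n) : A \is normalmx ->
  \sum_(z <- eigenvalues A) `|z| = \sum_j `|spectral_diag A 0 j|.
Proof.
by move=> An; rewrite (perm_big _ (spectral_eigenvalues An)) big_image.
Qed.

(** Puts the eigenvalues of a block in the form of diagonal entries, the only form that
    [sum_norm_diag_le] can bound. *)
Lemma sum_norm_eigenvalues_diag n (A : 'M[C]_n) : A \is normalmx ->
  \sum_(z <- eigenvalues A) `|z| =
  \sum_i `|(spectralmx A *m A *m (spectralmx A) ^t*) i i|.
Proof.
move=> An; rewrite sum_norm_eigenvalues //; apply: eq_bigr => i _.
have Pu := spectral_unitarymx A; have Pi := spectral_unit A.
move/orthomx_spectralP: An => {3}->.
by rewrite -invmx_unitary // !mulmxA mulmxV // mul1mx mulmxK // mxE eqxx.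
Qed.

(** Triangle inequality in each diagonal entry, then exchange of the two sums. The squared column
    norms of [V] stay explicit as the diagonal of [V ^t* *m V]: for a single block they need not be
    1, only their total over both blocks is. *)
Lemma sum_norm_diag_le m n (d : 'rV[C]_n) (V : 'M[C]_(m, n)) :
  \sum_i `|(V *m diag_mx d *m V ^t*) i i| <=
  \sum_j `|d 0 j| * (V ^t* *m V) j j.
Proof.
have -> : \sum_j `|d 0 j| * (V ^t* *m V) j j =
    \sum_i \sum_j `|d 0 j| * `|V i j| ^+ 2.
  rewrite exchange_big; apply: eq_bigr => j _; rewrite mxE mulr_sumr.
  by apply: eq_bigr => i _; rewrite !mxE normCK [_ * V i j]mulrC.
apply: ler_sum => i _; rewrite mxE; apply: le_trans (ler_norm_sum _ _ _) _.
apply: ler_sum => j _; rewrite mul_mx_diag !mxE !normrM norm_conjC.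
by rewrite mulrAC mulrC expr2.
Qed.

Lemma sum_norm_eigenvalues_mxsub m1 m2 n (M : 'M[C]_n)
    (h : 'I_m1 + 'I_m2 -> 'I_n) :
  M ^t* = M -> bijective h ->
  \sum_(z <- eigenvalues (mxsub (h \o inl) (h \o inl) M)) `|z|
  + \sum_(z <- eigenvalues (mxsub (h \o inr) (h \o inr) M)) `|z|
  <= \sum_(z <- eigenvalues M) `|z|.
Proof.
move=> hM bij_h; have Mn := hermitian_normal hM.
have sub_normal m (g : 'I_m -> 'I_n) : mxsub g g M \is normalmx.
  apply: hermitian_normal; apply/matrixP => i k.
  by rewrite -[in RHS]hM !mxE.
(* Row [i] of [E m g] is the basis vector of index [g i], so sandwiching [M] between [E m g] and its
   adjoint extracts the block. *)
pose E m (g : 'I_m -> 'I_n) : 'M[C]_(m, n) := rowsub g 1%:M.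
have subE m (g : 'I_m -> 'I_n) : mxsub g g M = E m g *m M *m (E m g) ^t*.
  rewrite mul_rowsub_mx mul1mx; apply/matrixP => i k; rewrite !mxE.
  rewrite (bigD1 (g k)) //= big1 ?addr0 => [|j /negPf jk]; rewrite !mxE.
    by rewrite eqxx rmorph1 mulr1.
  by rewrite eq_sym jk rmorph0 mulr0.
(* Bijectivity of [h] makes these two products complementary coordinate projections. *)
have EE : (E _ (h \o inl)) ^t* *m E _ (h \o inl)
        + (E _ (h \o inr)) ^t* *m E _ (h \o inr) = 1%:M.
  have entry m (g : 'I_m -> 'I_n) j k :
      ((E m g) ^t* *m E m g) j k = \sum_i ((g i == j) && (g i == k))%:R.
    rewrite mxE; apply: eq_bigr => i _.
    by rewrite !mxE conjC_nat -natrM mulnb.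
  apply/matrixP => j k; rewrite mxE !entry !mxE.
  transitivity (\sum_x ((h x == j) && (h x == k))%:R : C).
    by rewrite big_sumType.
  rewrite -(reindex h (P := predT) (F := fun y => ((y == j) && (y == k))%:R)) /=;
    last exact: onW_bij.
  by rewrite (bigD1 j) //= eqxx big1 ?addr0 // => y /negPf->.
pose P := spectralmx M; pose d := spectral_diag M.
have Pu : P \is unitarymx := spectral_unitarymx M.
have MP : M = P ^t* *m diag_mx d *m P.
  by rewrite -invmx_unitary //; apply/orthomx_spectralP.
have bound m (g : 'I_m -> 'I_n) :
    \sum_(z <- eigenvalues (mxsub g g M)) `|z| <=
    \sum_j `|d 0 j| * (P *m ((E m g) ^t* *m E m g) *m P ^t*) j j.
  rewrite sum_norm_eigenvalues_diag //; set A := mxsub g g M.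
  (* [Q] diagonalizes the block and [P] diagonalizes [M]; since [Q] is unitary, it cancels from
     [V ^t* *m V]. *)
  pose Q := spectralmx A; pose V := Q *m E m g *m P ^t*.
  have Vt : V ^t* = P *m (E m g) ^t* *m Q ^t*.
    by rewrite /V !trmx_mul !map_mxM trmxCK mulmxA.
  have QQ : Q ^t* *m Q = 1%:M.
    by rewrite -invmx_unitary ?spectral_unitarymx // mulVmx ?spectral_unit.
  have -> : Q *m A *m Q ^t* = V *m diag_mx d *m V ^t*.
    by rewrite Vt /A subE {1}MP /V !mulmxA.
  apply: le_trans (sum_norm_diag_le _ _) _.
  by rewrite Vt /V !mulmxA -[X in X *m E m g]mulmxA QQ mulmx1.
apply: le_trans (lerD (bound _ _) (bound _ _)) _.
rewrite sum_norm_eigenvalues // -big_split /=; apply: ler_sum => j _.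
(* Conjugating [EE] by the unitary [P] keeps the identity, so the two weights of each [d 0 j] add up
   to 1. *)
have := congr1 (fun X => (P *m X *m P ^t*) j j) EE.
rewrite mulmxDr mulmxDl mulmx1 (unitarymxP Pu) -mulrDr [in X in X -> _]mxE => ->.
by rewrite mxE eqxx mulr1.
Qed.

End TraceNorm.

Definition induced_incl (G : graph) (S U : {set G}) (sSU : S \subset U)
    (x : induced S) : induced U :=
  exist _ (val x) (subsetP sSU _ (valP x)).

Lemma induced_incl_val (G : graph) (S U : {set G}) (sSU : S \subset U) x :
  val (induced_incl sSU x) = val x.
Proof. by []. Qed.

(** Both matrices read [adj] on the same underlying vertices of [G]. The numberings of [S] and [U]
    are unrelated, so [g] passes through the vertices themselves. *)
Lemma adjacency_induced (C : numClosedFieldType) (G : graph) (S U : {set G})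
    (sSU : S \subset U) :
  let g i := enum_rank (induced_incl sSU (enum_val i)) in
  adjacency C (induced S) = mxsub g g (adjacency C (induced U)).
Proof. by move=> g; apply/matrixP => i j; rewrite !mxE !enum_rankK. Qed.

Lemma adjacency_hermitian (C : numClosedFieldType) (G : graph) :
  (adjacency C G) ^t* = adjacency C G.
Proof. by apply/matrixP => i j; rewrite !mxE conjC_nat adj_sym. Qed.

Theorem proposition3p2 (C : numClosedFieldType) (G : graph) :
  superadditive (@energy_game C G).
Proof.
move=> S T dST; rewrite /energy_game /energy.
rewrite (adjacency_induced C (subsetUl S T)) (adjacency_induced C (subsetUr S T)).
pose h (x : 'I_#|induced S| + 'I_#|induced T|) := match x with
  | inl i => enum_rank (induced_incl (subsetUl S T) (enum_val i))
  | inr i => enum_rank (induced_incl (subsetUr S T) (enum_val i))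
  end.
apply: (sum_norm_eigenvalues_mxsub (h := h)); first exact: adjacency_hermitian.
have disj (x : induced S) (y : induced T) : val x <> val y.
  move=> xy; have := in_set0 (val x).
  by rewrite -dST inE (valP x : _ \in S) xy (valP y : _ \in T).
(* Disjointness keeps the images of the two summands apart and also gives the equality of
   cardinals. *)
apply: inj_card_bij.
  case=> i [] j /= /enum_rank_inj /(congr1 val); rewrite !induced_incl_val.
  - by move=> /val_inj /enum_val_inj ->.
  - by move=> /disj.
  - by move=> /esym /disj.
  - by move=> /val_inj /enum_val_inj ->.
by rewrite card_sum !card_ord !card_sig -cardsUI dST cards0 addn0.
Qed.
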